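(* Let $\{X_t;\,t\ge 0\}$ be a simple bilateral birth--and--death process on $\mathbf{Z}$ with birth rates $\lambda_n>0$ and death rates $\mu_n>0$ ($n\in\mathbf{Z}$). Let $\{\ldots,\nu_{-1},\nu_0,\nu_1,\ldots\}$ be a strictly monotonic sequence of positive numbers satisfying $$\nu_{n+1}\lambda_n-\nu_n(\lambda_n+\mu_n)+\nu_{n-1}\mu_n=0\qquad\text{for all } n\in\mathbf{Z}.$$ Let $\widetilde X_t$ be a bilateral birth--and--death process on $\mathbf{Z}$ with birth rates $\widetilde\lambda_n$ and death rates $\widetilde\mu_n$ given by $$\widetilde\lambda_n=\lambda_n\,\frac{\nu_{n+1}}{\nu_n},\qquad \widetilde\mu_n=\mu_n\,\frac{\nu_{n-1}}{\nu_n}\qquad(n\in\mathbf{Z}).$$ Let $g_{k,s}(t)$ and $\widetilde g_{k,s}(t)$ denote the first--passage--time densities from state $k$ to state $s$ of $X_t$ and of $\widetilde X_t$, respectively. Then, for all $t>0$, $$\widetilde g_{k,s}(t)=\frac{\nu_s}{\nu_k}\,g_{k,s}(t)\qquad(k,s\in\mathbf{Z},\ k\ne s).$$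
   Context: A bilateral birth--and--death process is a birth--and--death process $\{X_t;\,t\ge0\}$ with state space the set of all integers $\mathbf{Z}=\{\ldots,-1,0,1,\ldots\}$ whose birth rates $\lambda_n=\lim_{\delta\downarrow0}\frac1\delta\Pr\{X_{t+\delta}=n+1\mid X_t=n\}$ and death rates $\mu_n=\lim_{\delta\downarrow0}\frac1\delta\Pr\{X_{t+\delta}=n-1\mid X_t=n\}$ are positive for every $n\in\mathbf{Z}$ (so there are no absorbing or reflecting states). The process is called simple if its set of rates $\{\lambda_n,\mu_n\}$ uniquely determines the birth--and--death process; in that case, for each initial state $k\in\mathbf{Z}$, the transition probabilities $p_{k,n}(t)=\Pr\{X_t=n\mid X_0=k\}$ are the unique solution of the forward system $$\frac{d}{dt}p_{k,n}(t)=\lambda_{n-1}\,p_{k,n-1}(t)-(\lambda_n+\mu_n)\,p_{k,n}(t)+\mu_{n+1}\,p_{k,n+1}(t)\qquad(n\in\mathbf{Z})$$ with initial conditions $p_{k,n}(0)=1$ if $n=k$ and $p_{k,n}(0)=0$ if $n\ne k$. For $k\ne s$, the first--passage--time density of $X_t$ through the state $s$, conditioned on $\Pr\{X_0=k\}=1$, is $$g_{k,s}(t)=\frac{d}{dt}\Pr\big(\inf\{u>0: X_u=s\}<t\mid X_0=k\big),$$ and $\widetilde g_{k,s}(t)$ is defined in the same way with $\widetilde X$ in place of $X$. These densities may be defective (their integral over $(0,\infty)$ may be less than $1$). *)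

(* Defs.v *)
From HB Require Import structures.
From mathcomp Require Import all_boot all_order all_algebra.
From mathcomp Require Import all_classical all_reals all_analysis.
Import Order.TTheory GRing.Theory Num.Theory.
Import numFieldNormedType.Exports.

Set Implicit Arguments.
Unset Strict Implicit.
Unset Printing Implicit Defensive.

Local Open Scope classical_set_scope.
Local Open Scope ring_scope.

(* A process is given by a family (P k) of laws on one measurable space of
   outcomes, P k being the conditional probability given X_0 = k, together with
   X : R -> T -> int; only the times t >= 0 are meaningful. *)

Section Process.
Context {R : realType} {d : measure_display} {T : measurableType d}.
Implicit Types (P : int -> probability T R) (X : R -> T -> int).

Definition at_state X (t : R) (n : int) : set T := [set w | X t w = n].

Definition trans_prob P X (k n : int) (t : R) : R :=
  fine (P k (at_state X t n)).

Definition history X (h : seq (R * int)) : set T :=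
  [set w | forall e, e \in h -> X e.1 w = e.2].

(* Elementary form, multiplied out so that no conditioning on a null event
   occurs, of
   Pr(X_(s+t) = j | X_s = i, X_(u_1) = n_1, ..., X_(u_m) = n_m) = p_(i,j)(t). *)
Definition markov P X : Prop :=
  forall (k i j : int) (h : seq (R * int)) (s t : R),
    0 <= s -> 0 <= t -> (forall e, e \in h -> 0 <= e.1 <= s) ->
    (P k (history X h `&` at_state X s i `&` at_state X (s + t) j) =
     P k (history X h `&` at_state X s i) * P i (at_state X t j))%E.

(* Right-continuous paths with left limits, for the discrete topology of Z: the
   path is Z-valued at all times and makes finitely many jumps in any bounded
   time interval, so it never leaves Z by running off to infinity. *)
Definition step_path (x : R -> int) : Prop :=
  (forall t, 0 <= t -> \forall u \near t^'+, x u = x t) /\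
  (forall t, 0 < t -> exists n, \forall u \near t^'-, x u = n).

End Process.

Section BirthDeath.
Context {R : realType}.
Implicit Types (lam mu : int -> R) (p : int -> int -> R -> R).

(* The third clause says that, from n, every transition other than those to
   n + 1 and n - 1 has probability o(h). *)
Definition bd_rates lam mu p : Prop :=
  forall n : int,
    [/\ p n (n + 1) h / h @[h --> 0^'+] --> lam n,
        p n (n - 1) h / h @[h --> 0^'+] --> mu n &
        (1 - p n n h) / h @[h --> 0^'+] --> lam n + mu n].

Record transition_function p : Prop := {
  tf_ge0 : forall k n t, 0 <= t -> 0 <= p k n t;
  tf_sum1 : forall k t, 0 <= t -> (\esum_(n in [set: int]) (p k n t)%:E = 1)%E;
  tf_init : forall k n, p k n 0 = (n == k)%:R;
  tf_chapman_kolmogorov : forall k n s t, 0 <= s -> 0 <= t ->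
    ((p k n (s + t))%:E = \esum_(j in [set: int]) (p k j s * p j n t)%:E)%E
}.

(* The rates determine the process: at most one transition function on Z has
   these rates. Paths play no role here, so for explosive rates the various
   continuations after explosion all count and simplicity fails. *)
Definition simple_rates lam mu : Prop :=
  forall p q, transition_function p -> bd_rates lam mu p ->
    transition_function q -> bd_rates lam mu q ->
    forall k n t, 0 <= t -> p k n t = q k n t.

Record bilateral_bd_process {d : measure_display} {T : measurableType d}
    (P : int -> probability T R) (X : R -> T -> int) lam mu : Prop := {
  bd_birth_gt0 : forall n, 0 < lam n;
  bd_death_gt0 : forall n, 0 < mu n;
  bd_measurable : forall t n, 0 <= t -> measurable (at_state X t n);
  bd_start : forall k, P k (at_state X 0 k) = 1%E;
  bd_paths : forall w, step_path (X ^~ w);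
  bd_markov : markov P X;
  bd_has_rates : bd_rates lam mu (trans_prob P X)
}.

End BirthDeath.

Section FirstPassage.
Context {R : realType} {d : measure_display} {T : measurableType d}.
Implicit Types (P : int -> probability T R) (X : R -> T -> int).

(* +oo when s is never visited. *)
Definition first_passage X (s : int) (w : T) : \bar R :=
  ereal_inf [set u%:E | u in [set u : R | 0 < u /\ X u w = s]].

Definition fpt_cdf P X (k s : int) (t : R) : R :=
  fine (P k [set w | (first_passage X s w < t%:E)%E]).

Definition fpt_density P X (k s : int) : R -> R := derive1 (fpt_cdf P X k s).

End FirstPassage.

(* Main.v *)
Require Import Defs.
From HB Require Import structures.
From mathcomp Require Import all_boot all_order all_algebra.
From mathcomp Require Import all_classical all_reals all_analysis.
From mathcomp Require Import lra ring zify.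
Import Order.TTheory GRing.Theory Num.Theory.
Import numFieldNormedType.Exports.

Local Open Scope classical_set_scope.
Local Open Scope ring_scope.

(* The recursion for nu says that nu is harmonic, so that lam' + mu' = lam + mu
   and the rates of X' are the Doob transform of those of X: q'_(n,i) =
   q_(n,i) nu_i / nu_n.  Along any chain of states from k to s the factors
   nu_i / nu_n telescope to nu_s / nu_k.

   To make this rigorous without the backward equations, observe the processes
   on the mesh of step h = t / (m + 1) and restrict to a finite window W of
   states other than s.  By the Markov property the probability of reaching s on
   the mesh without leaving W before is a finite sum of products of transition
   probabilities over one step; the one-step probabilities of the two processes
   agree up to the factor nu_i / nu_n and an error o(h), uniformly on the finite
   window, and these errors add up to m o(h) = o(1).  A step path is bounded on
   [0, t] and its visits to s are seen by all fine meshes, so letting first m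
   and then W grow shows that the distribution functions of the passage times are
   proportional. *)

(** * First visits of a discrete-time chain *)

Section Hitting.
Context {R : realType}.
Implicit Types (p q : int -> int -> R) (W : seq int).

(* Probability that the chain of kernel [p], started from [k], is at [i] at step
   [j] after spending the steps [0, ..., j - 1] in [W]. *)
Fixpoint taboo p W (k : int) (j : nat) (i : int) : R :=
  if j is j'.+1 then \sum_(n <- W) taboo p W k j' n * p n i else (i == k)%:R.

Lemma taboo_ge0 p W k j i : (forall n m, 0 <= p n m) -> 0 <= taboo p W k j i.
Proof.
move=> p0; elim: j i => [|j IH] i /=; first by rewrite ler0n.
by apply: sumr_ge0 => n _; rewrite mulr_ge0.
Qed.

(** Mass present in [W] at step [j + 1] was already in [W] at step [j], and the kernel is
    substochastic on [W], so the total never increases. *)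
Lemma taboo_sum_le1 p W k j : uniq W -> (forall n m, 0 <= p n m) ->
  (forall n, \sum_(m <- W) p n m <= 1) -> \sum_(i <- W) taboo p W k j i <= 1.
Proof.
move=> uW p0 p1; elim: j => [|j IH] /=.
  have [kW|kW] := boolP (k \in W).
    by rewrite (bigD1_seq k) //= eqxx big1 ?addr0 // => i /negPf ->.
  rewrite big_seq big1 // => i iW; case: eqVneq => // ik.
  by rewrite -ik iW in kW.
rewrite exchange_big /=; apply: le_trans IH.
apply: ler_sum => n _; rewrite -mulr_sumr.
by rewrite ler_piMr ?taboo_ge0.
Qed.

(* The error vector is propagated by the substochastic kernel [q] with [s] made
   absorbing, so its l1-norm grows by at most [K * e] per step. *)
Lemma taboo_error p q W (k s : int) (nu : int -> R) (K e : R) (N : nat) :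
  uniq W -> (forall n m, 0 <= p n m) -> (forall n m, 0 <= q n m) ->
  (forall n, \sum_(m <- W) p n m <= 1) ->
  (forall n, \sum_(m <- s :: W) q n m <= 1) ->
  (forall n, 0 < nu n) -> 0 <= K -> 0 <= e ->
  (forall n, n \in W -> nu n / nu k <= K) ->
  (forall n, n \in W ->
     \sum_(m <- s :: W) `|q n m - p n m * (nu m / nu n)| <= e) ->
  `|\sum_(j < N.+1) taboo q W k j s -
      nu s / nu k * \sum_(j < N.+1) taboo p W k j s|
    <= N%:R * (K * e).
Proof.
move=> uW p0 q0 p1 q1 nu0 K0 e0 nuK pq.
(* If [q] were exactly the Doob transform of [p], the factors would telescope along every chain and
   [d] would vanish. *)
pose d j i := taboo q W k j i - nu i / nu k * taboo p W k j i.
have nuV n : nu n != 0 by rewrite gt_eqF.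
have d0 i : d 0%N i = 0.
  rewrite /d /=; case: eqVneq => [->|_]; first by rewrite divff // mulr1 subrr.
  by rewrite mulr0 subrr.
(* The old error carried along by [q], plus a source term from the one-step discrepancy of the
   kernels. *)
have dS j i : d j.+1 i = \sum_(n <- W) d j n * q n i +
    \sum_(n <- W)
      nu n / nu k * taboo p W k j n * (q n i - p n i * (nu i / nu n)).
  rewrite /d /= mulr_sumr -sumrB -big_split /=; apply: eq_bigr => n _.
  by field; rewrite !nuV.
(* Error still in [W] and error already absorbed in [s] are bounded together, so that what [q] moves
   from [W] to [s] is counted once. The factor is [N] rather than [N + 1] because [d 0] vanishes. *)
suff H : \sum_(i <- W) `|d N i| + `|\sum_(j < N.+1) d j s| <= N%:R * (K * e).
  rewrite mulr_sumr -sumrB; apply: le_trans H.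
  by rewrite lerDr sumr_ge0.
elim: N => [|N IH].
  rewrite big_ord1 !d0 normr0 addr0 mul0r big1 // => i _.
  by rewrite d0 normr0.
have step : \sum_(i <- s :: W) `|d N.+1 i| <= \sum_(i <- W) `|d N i| + K * e.
  apply: (@le_trans _ _ (\sum_(i <- s :: W) (\sum_(n <- W) `|d N n| * q n i +
      \sum_(n <- W) nu n / nu k * taboo p W k N n *
         `|q n i - p n i * (nu i / nu n)|))).
    apply: ler_sum => i _; rewrite dS.
    apply: le_trans (ler_normD _ _) _; apply: lerD.
      apply: le_trans (ler_norm_sum _ _ _) _; apply: ler_sum => n _.
      by rewrite normrM (ger0_norm (q0 _ _)).
    apply: le_trans (ler_norm_sum _ _ _) _; apply: ler_sum => n _.
    by rewrite normrM ger0_norm // mulr_ge0 ?taboo_ge0 // divr_ge0 // ltW.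
  rewrite big_split /= exchange_big /= [X in _ + X]exchange_big /=.
  apply: lerD.
    apply: ler_sum => n _; rewrite -mulr_sumr ler_piMr //.
  apply: (@le_trans _ _ (\sum_(n <- W) K * taboo p W k N n * e)).
    rewrite big_seq [leRHS]big_seq; apply: ler_sum => n nW.
    rewrite -mulr_sumr.
    have h0 : 0 <= taboo p W k N n by exact: taboo_ge0.
    apply: ler_pM => //; last exact: pq.
    - by rewrite mulr_ge0 // divr_ge0 // ltW.
    - by apply: sumr_ge0.
    - by rewrite ler_wpM2r // nuK.
  rewrite -mulr_suml -mulr_sumr.
  rewrite -mulrA ler_wpM2l // ler_piMl //; exact: taboo_sum_le1.
rewrite big_cons in step.
rewrite big_ord_recr /=.
have := ler_normD (\sum_(i < N.+1) d i s) (d N.+1 s).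
rewrite -natr1 mulrDl mul1r => H; lra.
Qed.

End Hitting.

(** * The process observed on a mesh *)

Section FiniteDimensional.
Context {R : realType} {d : measure_display} {T : measurableType d}.

Lemma set_mem_cons (x : T -> int) n W :
  [set w | x w \in n :: W] = [set w | x w = n] `|` [set w | x w \in W].
Proof.
apply/seteqP; split => w /=; rewrite inE.
  by case/predU1P => ?; [left|right].
by case=> [->|->]; rewrite ?eqxx ?orbT.
Qed.

Lemma measurable_fibers (x : T -> int) (W : seq int) :
  (forall n, measurable [set w | x w = n]) -> measurable [set w | x w \in W].
Proof.
move=> mx; elim: W => [|n W IH].
  by rewrite (_ : mkset _ = set0) //; apply/seteqP; split.
by rewrite set_mem_cons; exact: measurableU.
Qed.

Lemma fine_measure_fibers (m : probability T R) (A : set T) (x : T -> int)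
    (W : seq int) :
  uniq W -> measurable A -> (forall n, measurable [set w | x w = n]) ->
  fine (m (A `&` [set w | x w \in W])) =
    \sum_(n <- W) fine (m (A `&` [set w | x w = n])).
Proof.
move=> + mA mx; elim: W => [_|n W IH /= /andP[nW uW]].
  rewrite big_nil (_ : _ `&` _ = set0) ?measure0 //.
  by apply/seteqP; split => // w [].
rewrite big_cons -IH //.
have mW : measurable [set w | x w \in W] by exact: measurable_fibers.
rewrite set_mem_cons setIUr measureU; [|exact: measurableI..|].
  by rewrite fineD // fin_num_measure //; exact: measurableI.
by apply/seteqP; split => // w /= [[_ xn]] [_]; rewrite xn (negPf nW).
Qed.

Variables (P : int -> probability T R) (X : R -> T -> int).
Hypothesis mX : forall t n, 0 <= t -> measurable (at_state X t n).
Hypothesis mkX : Defs.markov P X.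
Hypothesis X0 : forall k, P k (at_state X 0 k) = 1%E.

Definition stays (W : seq int) (us : seq R) : set T :=
  [set w | forall u, u \in us -> X u w \in W].

Lemma stays_cons W u us :
  stays W (u :: us) = stays W us `&` [set w | X u w \in W].
Proof.
apply/seteqP; split => w /= H.
  split=> [v vus|]; last by apply: H; rewrite mem_head.
  by apply: H; rewrite inE vus orbT.
move=> v; rewrite inE => /predU1P[->|]; first exact: H.2.
exact: H.1.
Qed.

Lemma measurable_stays W us : (forall u, u \in us -> 0 <= u) ->
  measurable (stays W us).
Proof.
elim: us => [|u us IH] us0.
  by rewrite (_ : stays _ _ = setT) //; apply/seteqP; split.
rewrite stays_cons; apply: measurableI.
  by apply: IH => v vus; apply: us0; rewrite inE vus orbT.
by apply: measurable_fibers => n; apply: mX; rewrite us0 // mem_head.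
Qed.

Lemma history_cons u n h :
  history X ((u, n) :: h) = history X h `&` at_state X u n.
Proof.
apply/seteqP; split => w /= H.
  split=> [e eh|]; first by apply: H; rewrite inE eh orbT.
  by apply: (H (u, n)); rewrite mem_head.
move=> e; rewrite inE => /predU1P[->|]; first exact: H.2.
exact: H.1.
Qed.

Lemma measurable_history h : (forall e, e \in h -> 0 <= e.1) ->
  measurable (history X h).
Proof.
elim: h => [|[u n] h IH] h0.
  by rewrite (_ : history _ _ = setT) //; apply/seteqP; split.
rewrite history_cons; apply: measurableI.
  by apply: IH => e eh; apply: h0; rewrite inE eh orbT.
by apply: mX; apply: (h0 (u, n)); rewrite mem_head.
Qed.

(* Conditioning on the value in [W] at a time of [us] moves that time into the
   history. *)
Lemma markov_stays W us h k i j s t : uniq W -> 0 <= s -> 0 <= t ->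
  (forall u, u \in us -> 0 <= u <= s) ->
  (forall e, e \in h -> 0 <= e.1 <= s) ->
  fine (P k (history X h `&` stays W us `&` at_state X s i
               `&` at_state X (s + t) j)) =
  fine (P k (history X h `&` stays W us `&` at_state X s i)) *
    trans_prob P X i j t.
Proof.
move=> uW s0 t0; elim: us h => [|u us IH] h us0 h0.
  rewrite (_ : stays _ _ = setT); last by apply/seteqP; split.
  rewrite setIT mkX // fineM // fin_num_measure //; last exact: mX.
  apply: measurableI; last exact: mX.
  by apply: measurable_history => e /h0/andP[].
have u0 : 0 <= u <= s by apply: us0; rewrite mem_head.
have us0' v : v \in us -> 0 <= v <= s.
  by move=> vus; apply: us0; rewrite inE vus orbT.
have mA : measurable (history X h `&` stays W us `&` at_state X s i).
  apply: measurableI; last exact: mX.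
  apply: measurableI; first by apply: measurable_history => e /h0/andP[].
  by apply: measurable_stays => v /us0'/andP[].
have mu n : measurable (at_state X u n) by apply: mX; case/andP: u0.
rewrite stays_cons setIA.
(* The event at time [u] goes last, so that both sides can be split over the value taken in [W]. *)
rewrite (setIAC _ [set w | _ \in _]) (setIAC _ [set w | _ \in _]).
rewrite !fine_measure_fibers //; last first.
  by apply: measurableI => //; apply: mX; rewrite addr_ge0.
rewrite mulr_suml; apply: eq_bigr => n _.
have := IH ((u, n) :: h) us0'.
rewrite history_cons => IHn.
have shift (A B C D E : set T) : A `&` B `&` C `&` D `&` E =
    A `&` E `&` B `&` C `&` D.
  by rewrite (setIAC _ D E) (setIAC _ C E) (setIAC _ B E).
rewrite shift IHn; last first.
  by move=> e; rewrite inE => /predU1P[->//|/h0].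
rewrite -/(at_state X u n).
rewrite -(setIA (history X h)) (setIC (at_state X u n)) setIA.
by rewrite (setIAC _ (at_state X u n)).
Qed.

Lemma stays_rcons W u us :
  stays W (rcons us u) = stays W us `&` [set w | X u w \in W].
Proof.
rewrite -stays_cons; apply/seteqP.
by split => w H v vus; apply: H; move: vus; rewrite mem_rcons.
Qed.

Lemma trans_prob_ge0 n m t : 0 <= trans_prob P X n m t.
Proof. exact: fine_ge0. Qed.

Lemma trans_prob_sum_le1 W n t : uniq W -> 0 <= t ->
  \sum_(m <- W) trans_prob P X n m t <= 1.
Proof.
move=> uW t0.
under eq_bigr => m _ do rewrite /trans_prob -[at_state _ _ _]setTI.
have mt m : measurable [set w | X t w = m] by exact: mX.
rewrite -fine_measure_fibers // setTI.
have mW := measurable_fibers (X t) W mt.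
rewrite -lee_fin fineK ?fin_num_measure //; exact: probability_le1.
Qed.

(** The event [at_state X 0 k] carries all the mass, so the events disjoint from it are null. *)
Lemma start_law k i : fine (P k (at_state X 0 i)) = (i == k)%:R.
Proof.
case: eqVneq => [->|ik]; first by rewrite X0.
have : (P k (at_state X 0 i `|` at_state X 0 k) <= 1)%E.
  by apply: probability_le1; apply: measurableU; exact: mX.
rewrite measureU; [|exact: mX|exact: mX|]; last first.
  by apply/seteqP; split => // w [/= Xi Xk]; rewrite -Xi -Xk eqxx in ik.
rewrite [X in (_ + X <= _)%E](X0 k) -[leRHS]add0e leeD2rE // => H.
by rewrite (_ : P k _ = 0%E) //; apply/eqP; rewrite eq_le H measure_ge0.
Qed.

(** The time [j * h] itself is left out: like [taboo], a condition on this grid concerns the steps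
    before [j] only. *)
Definition grid (h : R) (j : nat) : seq R := [seq l%:R * h | l <- iota 0 j].

Lemma gridS h j : grid h j.+1 = rcons (grid h j) (j%:R * h).
Proof. by rewrite /grid -addn1 iotaD map_cat /= cats1. Qed.

Lemma mem_grid h j u : 0 <= h -> u \in grid h j -> 0 <= u <= j%:R * h.
Proof.
move=> h0 /mapP[l]; rewrite mem_iota add0n => /andP[_ lj] ->.
by rewrite mulr_ge0 //= ler_wpM2r // ler_nat ltnW.
Qed.

(** The Markov property at time [j * h] reproduces the recursion that defines [taboo], with the
    transition probabilities over time [h] as kernel. *)
Lemma stays_grid_law W h k j i : uniq W -> 0 <= h ->
  fine (P k (stays W (grid h j) `&` at_state X (j%:R * h) i)) =
  taboo (fun n m => trans_prob P X n m h) W k j i.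
Proof.
move=> uW h0; elim: j i => [|j IH] i.
  rewrite (_ : stays _ _ = setT); last by apply/seteqP; split.
  by rewrite setTI mul0r start_law.
have jh0 : 0 <= j%:R * h by rewrite mulr_ge0.
have mS : measurable (stays W (grid h j)).
  by apply: measurable_stays => u /mem_grid -/(_ h0)/andP[].
rewrite gridS stays_rcons setIAC fine_measure_fibers //; first last.
- by move=> n; exact: mX.
- by apply: measurableI => //; apply: mX; rewrite mulr_ge0.
rewrite [RHS]/=; apply: eq_bigr => n _; rewrite -IH.
have := markov_stays W (grid h j) [::] k n i (j%:R * h) h uW jh0 h0.
rewrite (_ : history _ _ = setT); last by apply/seteqP; split.
rewrite setTI => <- //; last by move=> u /mem_grid ->.
by rewrite setIAC -natr1 mulrDl mul1r.
Qed.

Definition grid_hit (W : seq int) (s : int) (h : R) (N : nat) : set T :=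
  [set w | exists2 j, (j < N)%N &
     (stays W (grid h j) `&` at_state X (j%:R * h) s) w].

Lemma grid_hitS W s h N : grid_hit W s h N.+1 =
  grid_hit W s h N `|` (stays W (grid h N) `&` at_state X (N%:R * h) s).
Proof.
apply/seteqP; split => w /=.
  move=> [j]; rewrite ltnS leq_eqVlt => /predU1P[->|jN] H; first by right.
  by left; exists j.
move=> [[j jN H]|H]; first by exists j => //; rewrite ltnS ltnW.
by exists N.
Qed.

Lemma measurable_grid_hit W s h N : 0 <= h -> measurable (grid_hit W s h N).
Proof.
move=> h0; elim: N => [|N IH].
  by rewrite (_ : grid_hit _ _ _ _ = set0) //; apply/seteqP; split => // w [].
rewrite grid_hitS; apply: measurableU => //; apply: measurableI.
  by apply: measurable_stays => u /mem_grid -/(_ h0)/andP[].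
by apply: mX; rewrite mulr_ge0.
Qed.

(** Since [s] is not in [W], the chain cannot have been at [s] while staying in [W]; the events of
    hitting at different steps are thus disjoint and their probabilities add up. *)
Lemma grid_hit_law W s h k N : uniq W -> s \notin W -> 0 <= h ->
  fine (P k (grid_hit W s h N)) =
  \sum_(j < N) taboo (fun n m => trans_prob P X n m h) W k j s.
Proof.
move=> uW sW h0; elim: N => [|N IH].
  rewrite big_ord0 (_ : grid_hit _ _ _ _ = set0) ?measure0 //.
  by apply/seteqP; split => // w [].
have mH : measurable (stays W (grid h N) `&` at_state X (N%:R * h) s).
  apply: measurableI; last by apply: mX; rewrite mulr_ge0.
  by apply: measurable_stays => u /mem_grid -/(_ h0)/andP[].
have mG := measurable_grid_hit W s h N h0.
rewrite big_ord_recr /= -IH -stays_grid_law // grid_hitS measureU //.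
  by rewrite fineD // fin_num_measure.
apply/seteqP; split => // w [[j jN [_ /= Xs]] [/(_ (j%:R * h)) + _]].
rewrite Xs (negPf sW) => /(_ _)/notF; apply.
by apply/mapP; exists j => //; rewrite mem_iota.
Qed.

End FiniteDimensional.

(** * Infinitesimal rates *)

Section Rates.
Context {R : realType}.
Implicit Types (p q : int -> int -> R -> R) (lam mu nu : int -> R).

(* The rates out of [n] add up to [lam n + mu n], which leaves [o(h)] for all
   other states. *)
Lemma bd_rates_far p lam mu n m :
  bd_rates lam mu p -> (forall n m h, 0 < h -> 0 <= p n m h) ->
  (forall W n h, uniq W -> 0 < h -> \sum_(m <- W) p n m h <= 1) ->
  m != n -> m != n + 1 -> m != n - 1 ->
  p n m h / h @[h --> 0^'+] --> (0 : R).
Proof.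
move=> rp p0 p1 mn mn1 mn2; have [bn dn en] := rp n.
have up : ((1 - p n n h) / h - p n (n + 1) h / h - p n (n - 1) h / h)
    @[h --> 0^'+] --> (0 : R).
  have e0 : lam n + mu n - lam n - mu n = 0 by ring.
  by rewrite -[X in _ --> X]e0; apply: cvgB => //; exact: cvgB.
apply: (squeeze_cvgr _ (cvg_cst 0) up); near=> h.
have h0 : 0 < h by near: h; exact: nbhs_right_gt.
rewrite divr_ge0 ?p0 ?(ltW h0) //= -!mulrBl ler_pM2r ?invr_gt0 //.
have := p1 [:: m; n; n + 1; n - 1] n h.
rewrite !big_cons big_nil /= !inE !negb_or mn mn1 mn2 /=.
have -> : n != n + 1 by lia.
have -> : n != n - 1 by lia.
have -> : n + 1 != n - 1 by lia.
move=> /(_ isT h0); lra.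
Unshelve. all: by end_near. Qed.

(** The Doob relation between the kernels, to first order in [h]. On the diagonal it rests on the
    equality of the exit rates, at the two neighbours on the form of the new rates; at all other
    states both kernels are [o(h)]. *)
Lemma bd_rates_transform p q lam mu lam' mu' nu n m :
  bd_rates lam mu p -> bd_rates lam' mu' q ->
  (forall n m h, 0 < h -> 0 <= p n m h) ->
  (forall W n h, uniq W -> 0 < h -> \sum_(m <- W) p n m h <= 1) ->
  (forall n m h, 0 < h -> 0 <= q n m h) ->
  (forall W n h, uniq W -> 0 < h -> \sum_(m <- W) q n m h <= 1) ->
  (forall n, 0 < nu n) ->
  (forall n, lam' n = lam n * (nu (n + 1) / nu n)) ->
  (forall n, mu' n = mu n * (nu (n - 1) / nu n)) ->
  (forall n, lam' n + mu' n = lam n + mu n) ->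
  (q n m h - p n m h * (nu m / nu n)) / h @[h --> 0^'+] --> (0 : R).
Proof.
move=> rp rq p0 p1 q0 q1 nu0 lamE muE sumE.
have [bp dp ep] := rp n; have [bq dq eq] := rq n.
have [->|mn] := eqVneq m n.
  rewrite -[X in _ --> X](subrr (lam n + mu n)) -[X in _ - X]sumE.
  rewrite [X in X @ _ --> _](_ : _ =
    (fun h => (1 - p n n h) / h - (1 - q n n h) / h)); first exact: cvgB.
  apply/funext => h; rewrite divff ?gt_eqF // mulr1 -mulrBl; congr (_ / _).
  by ring.
have split_quotient : (fun h => (q n m h - p n m h * (nu m / nu n)) / h) =
    (fun h => q n m h / h - p n m h / h * (nu m / nu n)).
  by apply/funext => h; rewrite mulrBl mulrAC.
rewrite split_quotient.
have [mn1|mn1] := eqVneq m (n + 1).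
  rewrite -[X in _ --> X](subrr (lam' n)) [X in _ - X]lamE mn1.
  by apply: cvgB => //; apply: cvgM => //; exact: cvg_cst.
have [mn2|mn2] := eqVneq m (n - 1).
  rewrite -[X in _ --> X](subrr (mu' n)) [X in _ - X]muE mn2.
  by apply: cvgB => //; apply: cvgM => //; exact: cvg_cst.
have qm := bd_rates_far _ _ _ _ _ rq q0 q1 mn mn1 mn2.
have pm := bd_rates_far _ _ _ _ _ rp p0 p1 mn mn1 mn2.
rewrite -[X in _ --> X]subr0 -[X in _ - X](mul0r (nu m / nu n)).
by apply: cvgB => //; apply: cvgM => //; exact: cvg_cst.
Qed.

End Rates.

(** * Step paths *)

Section Paths.
Context {R : realType}.

(** Around each time the path takes at most two values, one on the left and one from that time on;
    compactness of [[0, t]] makes the local bounds uniform. *)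
Lemma step_path_bounded (x : R -> int) (t : R) : step_path x ->
  exists M : nat, forall u, 0 <= u <= t -> (`|x u| <= M)%N.
Proof.
move=> [xr xl].
have /compact_near_coveringP/near_covering_withinP cov :=
  @segment_compact R 0 t.
have /cov : forall u, `[0, t]%classic u ->
    \forall v \near u & M \near \oo, `[0, t]%classic v -> (`|x v| <= M)%N.
  move=> u /=; rewrite in_itv /= => /andP[u0 ut].
  have [n xn] : exists n, \forall v \near u^'-, 0 <= v -> x v = n.
    case: (ltrgtP 0 u) => [/xl[n xn]|/lt_geF|<-]; last 1 first.
    (* At [u = 0] there are no nonnegative times on the left, and the value 0 is a dummy. *)
    - exists 0; near=> v => v0.
      have : v < 0 by near: v; exact: nbhs_left_lt.
      by rewrite ltNge v0.
    - by exists n; apply: filterS xn.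
    - by rewrite u0.
  exists ([set v | v < u -> 0 <= v -> x v = n] `&` [set v | u < v -> x v = x u],
      [set M | (maxn `|n| `|x u| <= M)%N]).
    split=> /=; last by exists (maxn `|n| `|x u|).
    by apply: filterI; [exact: xn|exact: (xr u u0)].
  move=> [v M] /= [[vl vr] Mle]; rewrite in_itv /= => /andP[v0 _].
  case: (ltgtP v u) => [vu|uv|->].
  - by rewrite vl //; apply: leq_trans Mle; rewrite leq_maxl.
  - by rewrite vr //; apply: leq_trans Mle; rewrite leq_maxr.
  - by apply: leq_trans Mle; rewrite leq_maxr.
by move=> [M _ HM]; exists M => u ut; apply: (HM M) => //=; rewrite in_itv.
Unshelve. all: by end_near. Qed.

Lemma nbhs_infty_gtrS (r : R) : \forall n \near \oo, r < n.+1%:R.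
Proof.
apply: filterS (nbhs_infty_gtr r) => n /lt_le_trans; apply.
by rewrite ler_nat.
Qed.

(* A right-continuous integer path is constant just after any given time, so a
   sufficiently fine grid sees every visited state. *)
Lemma step_path_grid_visit (x : R -> int) (s : int) (t u : R) : step_path x ->
  0 <= u < t -> x u = s ->
  \forall m \near \oo, exists2 j, (0 < j < m.+1)%N &
    x (j%:R * (t / m.+1%:R)) = s.
Proof.
move=> [xr _] /andP[u0 ut] xus.
have t0 : 0 < t by exact: le_lt_trans ut.
have := xr u u0; rewrite xus => -[e /= e0 He].
have [c c0 [ce ct]] : exists2 c, 0 < c & c <= e /\ u + c <= t.
  exists (Num.min e (t - u)); first by rewrite lt_min e0 subr_gt0.
  by split; rewrite -?lerBrDl ge_min lexx ?orbT.
near=> m.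
have m0 : 0 < m.+1%:R :> R by rewrite ltr0n.
pose h := t / m.+1%:R.
have h0 : 0 < h by rewrite divr_gt0.
have hc : h < c.
  rewrite /h ltr_pdivrMr // mulrC -ltr_pdivrMr //.
  near: m; exact: nbhs_infty_gtrS.
(* The first mesh point strictly after [u]; it lies in []u, u + h]], where the path still has the
   value [s]. *)
pose j := (Num.truncn (u / h)).+1.
have uh : 0 <= u / h by rewrite divr_ge0 // ltW.
have /andP[jl jr] := truncn_itv uh.
have uj : u < j%:R * h by rewrite -ltr_pdivrMr.
have ju : j%:R * h <= u + h.
  rewrite /j -natr1 mulrDl mul1r lerD2r -ler_pdivlMr //.
exists j.
  apply/andP; split => //; rewrite -(ltr_nat R) -(ltr_pM2r h0).
  apply: le_lt_trans ju _.
  rewrite /h (mulrC m.+1%:R) divfK ?gt_eqF //.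
  by apply: lt_le_trans ct; rewrite ltrD2l.
apply: He => //=; rewrite -/h ltr0_norm ?subr_lt0 // opprB ltrBlDl.
by apply: le_lt_trans ju _; rewrite ltrD2l (lt_le_trans hc).
Unshelve. all: by end_near. Qed.

End Paths.

(** * Passage times as limits of mesh passage times *)

(** Filters are closed under finite intersections only; this is one place where finiteness of the
    window enters. *)
Lemma near_all_mem {A : eqType} {U : Type} (F : set_system U) {FF : Filter F}
    (W : seq A) (Q : A -> U -> Prop) :
  (forall a, \forall h \near F, Q a h) ->
  \forall h \near F, forall a, a \in W -> Q a h.
Proof.
move=> QF; elim: W => [|a W IH]; first by apply: nearW.
apply: filterS2 (QF a) IH => h Qa QW b; rewrite inE => /predU1P[->//|].
exact: QW.
Qed.

Lemma near_mesh {R : realType} (t : R) (Q : R -> Prop) : 0 < t ->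
  (\forall h \near 0^'+, Q h) -> \forall m \near \oo, Q (t / m.+1%:R).
Proof.
move=> t0 [e /= e0 He]; near=> m; apply: He => /=; last by rewrite divr_gt0.
rewrite sub0r normrN gtr0_norm ?divr_gt0 // ltr_pdivrMr ?ltr0n // mulrC.
by rewrite -ltr_pdivrMr //; near: m; exact: nbhs_infty_gtrS.
Unshelve. all: by end_near. Qed.

Lemma window_exists (M : nat) (s : int) : exists W : seq int,
  [/\ uniq W, s \notin W & forall n : int, (`|n| <= M)%N -> n != s -> n \in W].
Proof.
exists (rem s (undup [seq i%:Z - M%:Z | i <- iota 0 M.*2.+1])); split.
- by rewrite rem_uniq ?undup_uniq.
- by rewrite mem_rem_uniq ?undup_uniq // inE eqxx.
move=> n nM ns; rewrite mem_rem_uniq ?undup_uniq // inE ns mem_undup.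
apply/mapP; exists (absz (n + M%:Z)); last by lia.
by rewrite mem_iota; lia.
Qed.

(** Continuity from below along the sets [A] intersected with [B n], which increase to [A]. *)
Lemma measure_exhaustion {R : realType} {d : measure_display}
    {T : measurableType d} (m : probability T R) (A : set T) (B : nat -> set T)
    (e : R) : 0 < e -> measurable A -> (forall n, measurable (B n)) ->
  (forall i j w, (i <= j)%N -> B i w -> B j w) ->
  (forall w, A w -> exists n, B n w) ->
  exists n, fine (m A) - e < fine (m (A `&` B n)).
Proof.
move=> e0 mA mB ndB AB.
have mAB n : measurable (A `&` B n) by exact: measurableI.
have UE : \bigcup_n (A `&` B n) = A.
  apply/seteqP; split => w; first by case=> n _ [].
  by move=> Aw; have [n Bn] := AB w Aw; exists n.
have : m \o (fun n => A `&` B n) @ \oo --> m A.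
  rewrite -[X in _ --> m X]UE; apply: nondecreasing_cvg_mu => //.
    by rewrite UE.
  move=> i j ij; apply/subsetPset => w [Aw Bw]; split => //; exact: ndB Bw.
rewrite -(fineK (fin_num_measure m _ mA)) => /fine_cvgP[_].
move=> /cvgrPdist_lt/(_ e e0)[n _ /(_ n (leqnn n))] /= H.
by exists n; move: H; rewrite ltr_distlC => /andP[].
Qed.

Section Visits.
Context {R : realType} {d : measure_display} {T : measurableType d}.
Variables (P : int -> probability T R) (X : R -> T -> int) (lam mu : int -> R).
Hypothesis HX : bilateral_bd_process P X lam mu.

Let mX := bd_measurable HX.

(** The event that the first passage time is below [t], written without the infimum; both
    inequalities are strict, as in [first_passage] and [fpt_cdf]. *)
Definition visited (s : int) (t : R) : set T :=
  [set w | exists2 u, 0 < u < t & X u w = s].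

Definition mesh_visit (s : int) (t : R) (m : nat) : set T :=
  [set w | exists2 j, (0 < j < m.+1)%N & X (j%:R * (t / m.+1%:R)) w = s].

(** One bound for all meshes at once; only countably many times occur, which makes measurability
    immediate. *)
Definition mesh_bounded (t : R) (M : nat) : set T :=
  [set w | forall m j, (j < m.+1)%N -> (`|X (j%:R * (t / m.+1%:R)) w| <= M)%N].

Lemma mesh_ge0 (t : R) j m : 0 < t -> 0 <= j%:R * (t / m.+1%:R).
Proof. by move=> t0; rewrite mulr_ge0 // divr_ge0 // ltW. Qed.

Lemma mesh_lt (t : R) j m : 0 < t -> (j < m.+1)%N ->
  j%:R * (t / m.+1%:R) < t.
Proof.
move=> t0 jm; rewrite mulrA ltr_pdivrMr ?ltr0n // mulrC ltr_pM2l //.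
by rewrite ltr_nat.
Qed.

Lemma measurable_mesh_visit s t m : 0 < t -> measurable (mesh_visit s t m).
Proof.
move=> t0.
rewrite (_ : mesh_visit _ _ _ = \bigcup_(j in [set j | (0 < j < m.+1)%N])
    at_state X (j%:R * (t / m.+1%:R)) s).
  by apply: bigcup_measurable => j _; apply: mX; exact: mesh_ge0.
by apply/seteqP; split => w [j jm Xj]; exists j.
Qed.

Lemma measurable_mesh_bounded t M : 0 < t -> measurable (mesh_bounded t M).
Proof.
move=> t0; rewrite (_ : mesh_bounded _ _ =
   \bigcap_m \bigcap_(j in [set j | (j < m.+1)%N])
     [set w | (`|X (j%:R * (t / m.+1%:R)) w| <= M)%N]).
  apply: bigcapT_measurable => m; apply: bigcap_measurableType => j _.
  rewrite (_ : mkset _ = \bigcup_n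
      if (`|n| <= M)%N then at_state X (j%:R * (t / m.+1%:R)) n else set0).
    apply: countable_bigcupT_measurable => // n.
    by case: ifP => // _; apply: mX; exact: mesh_ge0.
  apply/seteqP; split => w /=; last by case=> n _; case: ifP => // nM /= ->.
  by move=> H; exists (X (j%:R * (t / m.+1%:R)) w) => //; rewrite H.
by apply/seteqP; split => w H; [move=> m _ j; exact: H|move=> m j; exact: H].
Qed.

Lemma visited_mesh s t w : visited s t w ->
  \forall m \near \oo, mesh_visit s t m w.
Proof.
move=> [u /andP[u0 ut] Xu].
by apply: (step_path_grid_visit (X ^~ w) s t u (bd_paths HX w)); rewrite ?ltW.
Qed.

Lemma mesh_visited s t m : 0 < t -> mesh_visit s t m `<=` visited s t.
Proof.
move=> t0 w [j /andP[j0 jm] Xj]; exists (j%:R * (t / m.+1%:R)) => //.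
by rewrite mesh_lt // andbT mulr_gt0 ?ltr0n // divr_gt0.
Qed.

(** By right-continuity every visit is seen by some mesh, which turns the uncountable union over
    times into a countable one. *)
Lemma measurable_visited s t : 0 < t -> measurable (visited s t).
Proof.
move=> t0; rewrite (_ : visited s t = \bigcup_m mesh_visit s t m).
  by apply: bigcupT_measurable => m; exact: measurable_mesh_visit.
apply/seteqP; split=> [w|w [m _]]; last exact: mesh_visited.
by move=> /visited_mesh[m _ /(_ m (leqnn m))]; exists m.
Qed.

(** A mesh hit at a positive step is a genuine visit before [t], and a hit at step 0 has probability
    0 because [k] differs from [s]. *)
Lemma grid_hit_le_visited W k s t m : 0 < t -> k != s ->
  fine (P k (grid_hit X W s (t / m.+1%:R) m.+1)) <= fine (P k (visited s t)).
Proof.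
move=> t0 ks.
have h0 : 0 <= t / m.+1%:R by rewrite divr_ge0 // ltW.
have mG := measurable_grid_hit X mX W s _ m.+1 h0.
have mV := measurable_visited s t t0.
have m0 : measurable (at_state X 0 s) by exact: mX.
have P0 : P k (at_state X 0 s) = 0%E.
  rewrite -(fineK (fin_num_measure _ _ m0)).
  by rewrite (start_law P X mX (bd_start HX)) eq_sym (negPf ks).
rewrite fine_le ?fin_num_measure //.
apply: (@le_trans _ _ (P k (visited s t `|` at_state X 0 s))).
  apply: le_measure; rewrite ?inE //; first exact: measurableU.
  move=> w [[|j] jm [_ /= Xj]]; first by right; rewrite mul0r in Xj.
  by left; apply: (mesh_visited s t m t0); exists j.+1.
apply: le_trans (measureU2 _ mV m0) _.
by rewrite [X in (_ + X)%E]P0 adde0.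
Qed.

(** One half of [e] pays for the paths not bounded by [M] on the meshes, the other half for those
    whose visit is missed by some mesh of index at least [N]. The window consists of states other
    than [s] and contains all those of absolute value at most [M]. *)
Lemma grid_hit_approx k s t e : 0 < t -> 0 < e ->
  exists W : seq int, [/\ uniq W, s \notin W & \forall m \near \oo,
    fine (P k (visited s t)) - e <
    fine (P k (grid_hit X W s (t / m.+1%:R) m.+1))].
Proof.
move=> t0 e0; have e20 : 0 < e / 2 by rewrite divr_gt0.
have mV := measurable_visited s t t0.
have [|||M HM] := measure_exhaustion (P k) _ (mesh_bounded t) _ e20 mV.
- by move=> M; exact: measurable_mesh_bounded.
- by move=> i j w ij H m l /H Hm; exact: leq_trans Hm ij.
- move=> w _; have [M HM] := step_path_bounded (X ^~ w) t (bd_paths HX w).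
  by exists M => m j jm; apply: HM; rewrite mesh_ge0 // ltW // mesh_lt.
have mVB : measurable (visited s t `&` mesh_bounded t M).
  by apply: measurableI => //; exact: measurable_mesh_bounded.
have [|||N HN] := measure_exhaustion (P k) _
  (fun n => \bigcap_(m in [set m | (n <= m)%N]) mesh_visit s t m) _ e20 mVB.
- move=> n; apply: bigcap_measurableType => m _.
  exact: measurable_mesh_visit.
- by move=> i j w ij H m /= jm; apply: H => /=; exact: leq_trans ij jm.
- by move=> w [/visited_mesh[n _ H] _]; exists n => m /=; exact: H.
have [W [uW sW inW]] := window_exists M s.
exists W; split => //; exists N => // m /= Nm.
suff H : fine (P k (visited s t `&` mesh_bounded t M `&`
      \bigcap_(m in [set m | (N <= m)%N]) mesh_visit s t m)) <=
    fine (P k (grid_hit X W s (t / m.+1%:R) m.+1)) by lra.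
have mG : measurable (grid_hit X W s (t / m.+1%:R) m.+1).
  by apply: measurable_grid_hit => //; rewrite divr_ge0 // ltW.
have mD : measurable (\bigcap_(m in [set m | (N <= m)%N]) mesh_visit s t m).
  by apply: bigcap_measurableType => l _; exact: measurable_mesh_visit.
rewrite fine_le ?fin_num_measure //; [exact: measurableI|].
apply: le_measure; rewrite ?inE //; [exact: measurableI|].
move=> w [[_ wM] /(_ m Nm)[j0 /andP[_ j0m] /eqP Xj0]].
(* At the least index of a visit, all earlier mesh values differ from [s] and are bounded by [M],
   hence lie in [W]. *)
have := ex_minnP (ex_intro (fun j => X (j%:R * (t / m.+1%:R)) w == s) j0 Xj0).
move=> [j /eqP Xj jmin].
have jm : (j < m.+1)%N by apply: leq_ltn_trans j0m; exact: jmin.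
exists j => //; split => // u /mapP[l].
rewrite mem_iota add0n => /andP[_ lj] ->.
apply: inW; first by apply: wM; exact: ltn_trans jm.
by apply: contraTneq lj => /eqP /jmin; rewrite -leqNgt.
Qed.

End Visits.

(** * Comparison of the two processes *)

Lemma transform_error {R : realType} (p q : int -> int -> R -> R)
    (lam mu lam' mu' nu : int -> R) (W : seq int) (k s : int) (t e : R) :
  bd_rates lam mu p -> bd_rates lam' mu' q ->
  (forall n m h, 0 < h -> 0 <= p n m h) ->
  (forall W n h, uniq W -> 0 < h -> \sum_(m <- W) p n m h <= 1) ->
  (forall n m h, 0 < h -> 0 <= q n m h) ->
  (forall W n h, uniq W -> 0 < h -> \sum_(m <- W) q n m h <= 1) ->
  (forall n, 0 < nu n) ->
  (forall n, lam' n = lam n * (nu (n + 1) / nu n)) ->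
  (forall n, mu' n = mu n * (nu (n - 1) / nu n)) ->
  (forall n, lam' n + mu' n = lam n + mu n) ->
  uniq W -> s \notin W -> 0 < t -> 0 < e ->
  \forall m \near \oo, let h := t / m.+1%:R in
    `|\sum_(j < m.+1) taboo (fun n i => q n i h) W k j s -
      nu s / nu k * \sum_(j < m.+1) taboo (fun n i => p n i h) W k j s| < e.
Proof.
move=> rp rq p0 p1 q0 q1 nu0 lamE muE sumE uW sW t0 e0.
have nuk0 n : 0 <= nu n / nu k by rewrite divr_ge0 // ltW.
(* A crude bound for the largest ratio over [W]. *)
pose K := \sum_(n <- W) nu n / nu k.
have K0 : 0 <= K by exact: sumr_ge0.
have KW n : n \in W -> nu n / nu k <= K.
  by move=> nW; rewrite /K (bigD1_seq n) //= lerDl sumr_ge0.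
(* With an error of [c * h] per entry, [m] steps cost at most [K * (size W + 1) * c * t]. Taking
   [K + 1] here keeps the divisor positive when [W] is empty and makes the final inequality
   strict. *)
pose c := e / ((K + 1) * (size W).+1%:R * t).
have S0 : 0 < (K + 1) * (size W).+1%:R * t.
  by rewrite !mulr_gt0 ?ltr0n // ltr_wpDl.
have cE : (K + 1) * (size W).+1%:R * t * c = e by rewrite mulrC divfK // gt_eqF.
have c0 : 0 < c by rewrite divr_gt0.
clearbody c.
have close : \forall h \near 0^'+, forall n, n \in W ->
    forall i, i \in s :: W -> `|q n i h - p n i h * (nu i / nu n)| <= c * h.
  apply: near_all_mem => n; apply: near_all_mem => i.
  have /cvgrPdist_le/(_ c c0) := bd_rates_transform p q lam mu lam' mu' nu n i
    rp rq p0 p1 q0 q1 nu0 lamE muE sumE.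
  apply: filterS2 (nbhs_right_gt 0) => h h0.
  by rewrite sub0r normrN normrM normfV (gtr0_norm h0) ler_pdivrMr.
apply: filterS (near_mesh t _ t0 close) => m Hm; set h := t / _ in Hm *.
have h0 : 0 < h by rewrite divr_gt0.
have err : forall n, n \in W ->
    \sum_(i <- s :: W) `|q n i h - p n i h * (nu i / nu n)| <=
    (size W).+1%:R * (c * h).
  move=> n nW; apply: (@le_trans _ _ (\sum_(i <- s :: W) c * h)).
    by rewrite big_seq [leRHS]big_seq; apply: ler_sum => i; exact: Hm.
  by rewrite big_const_seq count_predT iter_addr_0 mulr_natl.
apply: le_lt_trans
  (taboo_error _ _ _ _ _ nu K _ m uW _ _ _ _ nu0 K0 _ KW err) _.
- by move=> *; exact: p0.
- by move=> *; exact: q0.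
- by move=> *; exact: p1.
- by move=> *; apply: q1; rewrite //= sW.
- by rewrite !mulr_ge0 // ltW.
have mh : m%:R * h < t by rewrite mesh_lt.
have -> : m%:R * (K * ((size W).+1%:R * (c * h))) =
    K * (size W).+1%:R * c * (m%:R * h) by ring.
rewrite -cE mulrAC [ltRHS]mulrAC.
have Sc : 0 < (size W).+1%:R * c by rewrite mulr_gt0 ?ltr0n.
have := mulr_ge0 (ltW Sc) K0.
have mh0 : 0 <= m%:R * h by rewrite mulr_ge0 // ltW.
have ScK : 0 <= K * ((size W).+1%:R * c) by rewrite mulr_ge0 // ltW.
have := ler_wpM2l ScK (ltW mh); have := mulr_gt0 Sc t0; lra.
Qed.

Section Comparison.
Context {R : realType} {d d' : measure_display}.
Context {T : measurableType d} {T' : measurableType d'}.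

(** One inequality suffices: the inverse transform, with [1 / nu], has the same form and yields the
    other. *)
Lemma visited_le (P : int -> probability T R) (X : R -> T -> int)
    (P' : int -> probability T' R) (X' : R -> T' -> int)
    (lam mu lam' mu' nu : int -> R) (k s : int) (t : R) :
  bilateral_bd_process P X lam mu -> bilateral_bd_process P' X' lam' mu' ->
  (forall n, 0 < nu n) ->
  (forall n, lam' n = lam n * (nu (n + 1) / nu n)) ->
  (forall n, mu' n = mu n * (nu (n - 1) / nu n)) ->
  (forall n, lam' n + mu' n = lam n + mu n) -> k != s -> 0 < t ->
  nu s / nu k * fine (P k (visited X s t)) <= fine (P' k (visited X' s t)).
Proof.
move=> HX HX' nu0 lamE muE sumE ks t0.
have mX := bd_measurable HX; have mX' := bd_measurable HX'.
pose c := nu s / nu k; have c0 : 0 < c by rewrite divr_gt0.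
apply/ler_addgt0Pr => e e0.
(* The mesh approximation for [X] gets multiplied by [c], hence the division; the other half of [e]
   covers the error of the transform. *)
have e20 : 0 < e / 2 / c by rewrite !divr_gt0.
have [W [uW sW lower]] := grid_hit_approx P X lam mu HX k s t _ t0 e20.
have e2 : 0 < e / 2 by rewrite divr_gt0.
have err := transform_error _ _ lam mu lam' mu' nu W k s t _
  (bd_has_rates HX) (bd_has_rates HX')
  (fun n m h _ => trans_prob_ge0 P X n m h)
  (fun W n h uW h0 => trans_prob_sum_le1 P X mX W n h uW (ltW h0))
  (fun n m h _ => trans_prob_ge0 P' X' n m h)
  (fun W n h uW h0 => trans_prob_sum_le1 P' X' mX' W n h uW (ltW h0))
  nu0 lamE muE sumE uW sW t0 e2.
have [m [Hlow]] := filter_ex (filterI lower err).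
have h0 : 0 <= t / m.+1%:R by rewrite divr_ge0 // ltW.
rewrite -(grid_hit_law P X mX (bd_markov HX) (bd_start HX)) //.
rewrite -(grid_hit_law P' X' mX' (bd_markov HX') (bd_start HX')) // -/c.
have := grid_hit_le_visited P' X' lam' mu' HX' W k s t m t0 ks.
rewrite ltr_distlC => Hup /andP[_ Hdist].
move: Hlow; rewrite -(ltr_pM2l c0) mulrBr [c * (_ / _)]mulrC divfK ?gt_eqF //.
lra.
Qed.

Lemma visitedE (P : int -> probability T R) (X : R -> T -> int) (k s : int) t :
  fpt_cdf P X k s t = fine (P k (visited X s t)).
Proof.
congr (fine (P k _)); apply/seteqP; split => w /=.
  move=> /ereal_inf_lt[_ /= [u [u0 Xu] <-]]; rewrite lte_fin => ut.
  by exists u => //; rewrite u0.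
move=> [u /andP[u0 ut] Xu]; apply: (@le_lt_trans _ _ u%:E).
  by apply: ereal_inf_lbound; exists u.
by rewrite lte_fin.
Qed.

End Comparison.

(** * From distribution functions to densities *)

(* Also where [f] is not derivable: the derivative is then [0] on both sides. *)
Lemma derive1_scale {R : realType} (f g : R -> R) (c t : R) : c != 0 ->
  (\forall u \near t, g u = c * f u) -> derive1 g t = c * derive1 f t.
Proof.
move=> c0 gf.
pose F (h : R) := h^-1 *: (f (h + t) - f t).
pose G (h : R) := h^-1 *: (g (h + t) - g t).
have FG : {near 0^', (fun h => c * F h) =1 G}.
  have : \forall h \near 0^', g (h + t) = c * f (h + t).
    apply: nbhs_dnbhs; move/nbhs0P: gf.
    by apply: filterS => h; rewrite addrC.
  apply: filterS => h gh; rewrite /F /G gh (nbhs_singleton gf) -mulrBr /=.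
  by rewrite /GRing.scale /= mulrCA.
have GF : {near 0^', (fun h => c^-1 * G h) =1 F}.
  by apply: filterS FG => h <-; rewrite mulKf.
rewrite /derive1 -/F -/G.
have [cF|dF] := pselect (cvg (F h @[h --> 0^'])).
  apply: cvg_lim => //; apply: cvg_trans (near_eq_cvg FG) _.
  by apply: cvgM => //; exact: cvg_cst.
(* Convergence of [G] would force that of [F], since [F] is [c^-1 * G] near 0; hence both limits
   take the default value 0. *)
rewrite (dvgP dF) dvgP ?mulr0 // => cG; apply: dF.
suff : F h @[h --> 0^'] --> c^-1 * lim (G h @[h --> 0^']) by move/cvgP.
apply: cvg_trans (near_eq_cvg GF) _.
by apply: cvgM => //; exact: cvg_cst.
Qed.

Theorem theorem2 (R : realType)
    (d : measure_display) (T : measurableType d)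
    (P : int -> probability T R) (X : R -> T -> int)
    (d' : measure_display) (T' : measurableType d')
    (P' : int -> probability T' R) (X' : R -> T' -> int)
    (lam mu nu : int -> R)
    (HX : bilateral_bd_process P X lam mu)
    (Hsimple : simple_rates lam mu)
    (Hnu_gt0 : forall n : int, 0 < nu n)
    (Hnu_mono : (forall m n : int, m < n -> nu m < nu n) \/
                (forall m n : int, m < n -> nu n < nu m))
    (Hnu_rec : forall n : int,
       nu (n + 1) * lam n - nu n * (lam n + mu n) + nu (n - 1) * mu n = 0)
    (HX' : bilateral_bd_process P' X'
       (fun n : int => lam n * (nu (n + 1) / nu n))
       (fun n : int => mu n * (nu (n - 1) / nu n))) :
  forall (k s : int) (t : R), k <> s -> 0 < t ->
    fpt_density P' X' k s t = nu s / nu k * fpt_density P X k s t.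
Proof.
move=> k s t ks t0.
have ks' : k != s by exact/eqP.
have nuN0 n : nu n != 0 by rewrite gt_eqF.
have sumE n : lam n * (nu (n + 1) / nu n) + mu n * (nu (n - 1) / nu n) =
    lam n + mu n.
  apply: (mulIf (nuN0 n)); rewrite mulrDl -!mulrA !mulVf // !mulr1.
  have := Hnu_rec n; lra.
apply: derive1_scale; first by rewrite mulf_neq0 ?invr_eq0.
(* The derivative at [t] needs the proportionality on a neighbourhood of [t], and all nearby [u] are
   positive. *)
apply: filterS (lt_nbhsr t0) => u u0.
rewrite !visitedE; apply/eqP; rewrite eq_le; apply/andP; split; last first.
  exact: (visited_le _ _ _ _ _ _ _ _ nu k s u HX HX').
have c0 : 0 < nu s / nu k by rewrite divr_gt0.
(* For the reverse inequality the roles are exchanged: the rates of [X] are the transform of those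
   of [X'] by [1 / nu]. *)
rewrite -ler_pdivrMl // (_ : (nu s / nu k)^-1 = (nu s)^-1 / (nu k)^-1).
  apply: (visited_le _ _ _ _ _ _ lam mu
    (fun n => (nu n)^-1) k s u HX' HX) => //.
  - by move=> n; rewrite invr_gt0.
  - by move=> n; field; rewrite !nuN0.
  - by move=> n; field; rewrite !nuN0.
by rewrite invrM ?unitfE ?invr_eq0 // invrK mulrC.
Qed.
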